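(* Let $H\in(\tfrac12,1)$, and let $\Gamma_n^k$ ($n\ge 2$, $2\le k\le n$) be the projection coefficients of fractional Gaussian noise with Hurst index $H$, as defined in the context. Then for all $n\ge 1$, $$\Gamma_{n+1}^2>0.$$
   Context: Let $B^H=\{B^H_t,t\ge0\}$ be a fractional Brownian motion with Hurst index $H$, i.e. a centred Gaussian process with covariance $\tfrac12(t^{2H}+s^{2H}-|t-s|^{2H})$, and let $\Delta_n=B^H_n-B^H_{n-1}$, $n\ge 1$, be its increments (fractional Gaussian noise). They form a stationary Gaussian sequence with autocovariance $\rho_k=\mathbb{E}\Delta_1\Delta_{k+1}=\tfrac12(|k+1|^{2H}-2|k|^{2H}+|k-1|^{2H})$, $k\ge 0$ (so $\rho_0=1$). For $n\ge 2$ the real coefficients $\Gamma_n^k$, $2\le k\le n$, are defined by $\mathbb{E}(\Delta_1\mid\Delta_2,\dots,\Delta_n)=\sum_{k=2}^n\Gamma_n^k\Delta_k$; equivalently, they are the unique solution of the linear system $\rho_{l-1}=\sum_{k=2}^n\Gamma_n^k\rho_{|l-k|}$, $2\le l\le n$ (whose coefficient matrix is nonsingular). *)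

(* Defs.v *)
From HB Require Import structures.
From mathcomp Require Import all_boot all_order all_algebra.
From mathcomp Require Import all_classical all_reals all_analysis measurable_realfun.

Set Implicit Arguments.
Unset Strict Implicit.
Unset Printing Implicit Defensive.

Import Order.TTheory GRing.Theory Num.Theory.
Import numFieldNormedType.Exports.

Local Open Scope classical_set_scope.
Local Open Scope ring_scope.

(* [normal_prob m 0] is a junk value in the library (the uniform law on [0, 1]),
   hence the separate treatment of the degenerate Gaussian law. *)
Definition gaussian_rv d (T : measurableType d) (R : realType)
    (P : probability T R) (X : {RV P >-> R}) : Prop :=
  exists m s : R, 0 <= s /\
    forall A : set R, measurable A ->
      distribution P X A = if s == 0 then \d_m A else normal_prob m s A.

(* Processes are indexed by the whole of R for convenience; their values at
   negative times are never constrained nor used. *)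
Definition gaussian_process d (T : measurableType d) (R : realType)
    (P : probability T R) (X : R -> {RV P >-> R}) : Prop :=
  forall (n : nat) (t c : 'I_n -> R), (forall i, 0 <= t i) ->
    gaussian_rv (P := P) (\sum_(i < n) c i *: X (t i)).

Definition fractional_brownian_motion d (T : measurableType d) (R : realType)
    (P : probability T R) (H : R) (B : R -> {RV P >-> R}) : Prop :=
  [/\ gaussian_process B,
      (forall t, 0 <= t -> ('E_P[B t] = 0)%E) &
      (forall t s, 0 <= t -> 0 <= s ->
         covariance P (B t) (B s) =
         (2^-1 * (t `^ (2 * H) + s `^ (2 * H) - `|t - s| `^ (2 * H)))%:E)].

Definition fbm_increment d (T : measurableType d) (R : realType)
    (P : probability T R) (B : R -> {RV P >-> R}) (n : nat) : {RV P >-> R} :=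
  B n%:R - B n.-1%:R.

Definition sigma_generated d (T : measurableType d) (R : realType)
    (I : set nat) (X : nat -> T -> R) : set (set T) :=
  <<s \bigcup_(k in I) preimage_set_system setT (X k) measurable >>.

(* [Z] is a version of the conditional expectation of [X] given the
   sub-sigma-algebra [G], i.e., E(X | G) = Z almost surely. *)
Definition is_cond_expectation d (T : measurableType d) (R : realType)
    (P : probability T R) (G : set (set T)) (X Z : T -> R) : Prop :=
  [/\ P.-integrable setT (EFin \o X),
      P.-integrable setT (EFin \o Z),
      (forall A : set R, measurable A -> G (Z @^-1` A)) &
      (forall A : set T, G A ->
         (\int[P]_(w in A) (Z w)%:E = \int[P]_(w in A) (X w)%:E)%E)].

(* E(D_1 | D_2, ..., D_n) = \sum_(2 <= k <= n) Gamma n k * D_k for every n >= 2,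
   where D_k is the k-th increment of [B]; the values [Gamma n k] outside the
   range 2 <= k <= n are unconstrained. *)
Definition projection_coefficients d (T : measurableType d) (R : realType)
    (P : probability T R) (B : R -> {RV P >-> R}) (Gamma : nat -> nat -> R) :
    Prop :=
  forall n : nat, (2 <= n)%N ->
    is_cond_expectation P
      (sigma_generated [set k | (2 <= k <= n)%N] (fbm_increment B))
      (fbm_increment B 1)
      (fun w => \sum_(2 <= k < n.+1) Gamma n k * fbm_increment B k w).

(* Main.v *)
Require Import Defs.
From HB Require Import structures.
From mathcomp Require Import all_boot all_order all_algebra finmap.
From mathcomp Require Import all_classical all_reals all_analysis measurable_realfun.
From mathcomp Require Import ring lra zify.

Set Implicit Arguments.
Unset Strict Implicit.
Unset Printing Implicit Defensive.

Import Order.TTheory GRing.Theory Num.Theory.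
Import numFieldNormedType.Exports.

Local Open Scope classical_set_scope.
Local Open Scope ring_scope.

(* Put p = 1 - \sum_j b_j 'X^j, where the b_j are the coefficients predicting a
   noise value from its n - 1 predecessors, and identify 'X^j with Delta_(j + 2).
   Projecting Delta_1 on Delta_2, ..., Delta_(n + 1) and pairing with p gives
   Gamma_(n + 1)^2 * <p, p> = Cov (Delta_1, p) = \sum_j p_j rho_(j + 1).
   Since p is orthogonal to 'X, ..., 'X^(n - 1), it has no root in [0, 1], so
   it is positive there. As the sequence rho_(j + 1) is completely monotone,
   i.e. the moment sequence of a positive measure on [0, 1], the right-hand side
   is positive; no measure is needed, because the Bernstein coefficients of p
   are eventually positive.
   Complete monotonicity of rho comes from the signs of the derivatives of
   t ^ (2 H), and positive definiteness from the convexity of rho. *)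

(** * Linear functionals on polynomials *)

Section CoefficientFunctional.
Context {R : realType}.
Implicit Types (u : nat -> R) (p q : {poly R}).

(** The moment functional of [u]: if [u] were the moment sequence of a measure, this would be the
    integral of [p]. *)
Definition lfun u p : R := \sum_(i < size p) p`_i * u i.

Lemma lfunE u p n : (size p <= n)%N -> lfun u p = \sum_(i < n) p`_i * u i.
Proof.
move=> pn; rewrite /lfun -!(big_mkord xpredT (fun i => p`_i * u i)).
rewrite (big_cat_nat _ pn)//= [X in _ = _ + X]big_nat [X in _ = _ + X]big1 ?addr0//.
by move=> i /andP[pi _]; rewrite nth_default ?mul0r.
Qed.

Lemma lfun_linear u : linear (lfun u).
Proof.
move=> a /= p q; pose n := maxn (size p) (size q).
have pn : (size p <= n)%N by apply: leq_maxl.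
have qn : (size q <= n)%N by apply: leq_maxr.
have pqn : (size (a *: p + q : {poly R})%R <= n)%N.
  rewrite (leq_trans (size_polyD _ _))// geq_max qn andbT.
  exact: leq_trans (size_scale_leq _ _) pn.
rewrite (lfunE u pn) (lfunE u qn) (lfunE u pqn) scaler_sumr -big_split/=.
by apply: eq_bigr => i _; rewrite coefD coefZ mulrDl scalerAl.
Qed.

HB.instance Definition _ u := GRing.isLinear.Build R {poly R} R _ (lfun u) (lfun_linear u).

Lemma lfunXn u n : lfun u 'X^n = u n.
Proof.
rewrite (@lfunE _ _ n.+1) ?size_polyXn// big_ord_recr/= coefXn eqxx mul1r.
by rewrite big1 ?add0r// => i _; rewrite coefXn ltn_eqF// mul0r.
Qed.

Lemma lfunC u c : lfun u c%:P = c * u 0%N.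
Proof. by rewrite -[c%:P]mulr1 mul_polyC linearZ/= -(expr0 'X) lfunXn. Qed.

Lemma lfunMX u p : lfun u (p * 'X) = lfun (fun i => u i.+1) p.
Proof.
rewrite (@lfunE _ _ (size p).+1);
  last by have [->|p0] := eqVneq p 0; rewrite ?mul0r ?size_poly0// size_mulX.
rewrite big_ord_recl coefMX eqxx mul0r add0r.
by apply: eq_bigr => i _; rewrite coefMX.
Qed.

Lemma eq_lfun u v p : (forall i, (i < size p)%N -> u i = v i) -> lfun u p = lfun v p.
Proof. by move=> uv; apply: eq_bigr => i _; rewrite uv. Qed.

Lemma lfun_sum_seq (I : Type) (s : seq I) (c : I -> R) (f : I -> nat -> R) p :
  lfun (fun j => \sum_(i <- s) c i * f i j) p = \sum_(i <- s) c i * lfun (f i) p.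
Proof.
rewrite /lfun; under eq_bigr do rewrite mulr_sumr.
rewrite exchange_big/=; apply: eq_bigr => i _.
by rewrite mulr_sumr; apply: eq_bigr => j _; rewrite mulrCA.
Qed.

End CoefficientFunctional.

(** * Positivity through Bernstein coefficients *)

Section Bernstein.
Context {R : realType}.
Implicit Types (u : nat -> R) (p : {poly R}).

Lemma ffactD n i k : (n ^_ (i + k) = n ^_ i * (n - i) ^_ k)%N.
Proof.
elim: k => [|k IH]; first by rewrite addn0 muln1.
by rewrite addnS !ffactnSr IH subnDA mulnA.
Qed.

(** Multiplied by k!, both sides become the falling factorial [N ^_ (i + k)]. *)
Lemma ffact_bin i k N : (k + i <= N)%N ->
  ((k + i) ^_ i * 'C(N, k + i) = N ^_ i * 'C(N - i, k))%N.
Proof.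
move=> kiN; apply/eqP; rewrite -(eqn_pmul2r (fact_gt0 k)); apply/eqP.
have E : ((k + i) ^_ i * k`! = (k + i)`!)%N.
  by have := ffact_fact (leq_addl k i); rewrite addnK.
by rewrite mulnAC E mulnC bin_ffact -mulnA bin_ffact addnC ffactD.
Qed.

(** Binomial expansion of ['X^i * ((1 - 'X) + 'X) ^+ (N - i)]; the terms with [j < i] carry
    [j ^_ i = 0]. *)
Lemma monomial_bernstein i N : (i <= N)%N ->
  'X^i = \sum_(j < N.+1) ((j ^_ i)%:R / (N ^_ i)%:R * 'C(N, j)%:R)
           *: ('X^j * (1 - 'X) ^+ (N - j)) :> {poly R}.
Proof.
move=> iN.
have N0 : (N ^_ i)%:R != 0 :> R by rewrite pnatr_eq0 -lt0n ffact_gt0.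
rewrite -(big_mkord xpredT (fun j => ((j ^_ i)%:R / (N ^_ i)%:R * 'C(N, j)%:R)
           *: ('X^j * (1 - 'X) ^+ (N - j)))).
rewrite (big_cat_nat _ (leqW iN))//= big_nat big1 ?add0r; last first.
  by move=> j /andP[_ ji]; rewrite ffact_small// !mul0r scale0r.
rewrite -[X in \big[_/_]_(X <= _ < _) _]add0n big_addn subSn// big_mkord.
rewrite -{1}['X^i]mulr1 -[X in _ * X](expr1n _ (N - i)) -[X in X ^+ (N - i)](subrK 'X 1).
rewrite exprDn mulr_sumr; apply: eq_bigr => k _.
have kN : (k + i <= N)%N by have := ltn_ord k; lia.
rewrite mulrAC -natrM ffact_bin// natrM mulrAC mulfV// mul1r.
rewrite scaler_nat mulrnAr [(k + i)%N]addnC subnDA exprD; congr (_ *+ _); ring.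
Qed.

(** Both quantities are products of [i] factors in [0, 1], namely (j - t) / (N - t) and j / N.
    Corresponding factors differ by at most 2d / N, and the errors add up. *)
Lemma ffact_ratio_dist (d N i j : nat) : (i <= d)%N -> (2 * d <= N)%N -> (0 < N)%N ->
  (j <= N)%N ->
  `|(j ^_ i)%:R / (N ^_ i)%:R - (j%:R / N%:R) ^+ i| <= i%:R * (2 * d%:R / N%:R) :> R.
Proof.
move=> + dN N0 jN; elim: i => [|i IH] id.
  by rewrite !ffactn0 expr0 divr1 subrr normr0 mul0r.
have iN : (i < N)%N by lia.
have NR : 0 < N%:R :> R by rewrite ltr0n.
pose x : R := j%:R / N%:R.
have x0 : 0 <= x by rewrite divr_ge0.
have x1 : x <= 1 by rewrite ler_pdivrMr// mul1r ler_nat.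
pose A : R := (j ^_ i)%:R / (N ^_ i)%:R.
have A0 : 0 <= A by rewrite divr_ge0.
have A1 : A <= 1.
  rewrite ler_pdivrMr ?ltr0n ?ffact_gt0 1?ltnW// mul1r ler_nat.
  by rewrite !ffact_prod leq_prod// => k _; exact: leq_sub2r.
pose b : R := (j - i)%:R / (N - i)%:R.
have bx : `|b - x| <= 2 * d%:R / N%:R.
  (* For [j <= i] truncated subtraction makes [b = 0], and [x] itself is small. *)
  have [ji|ij] := leqP j i.
    rewrite /b (eqP (ji : (j - i == 0)%N)) mul0r sub0r normrN ger0_norm//.
    by rewrite /x ler_wpM2r ?invr_ge0// -natrM ler_nat; lia.
  have iNR : 0 < N%:R - i%:R :> R by rewrite subr_gt0 ltr_nat.
  have -> : b - x = - (i%:R * (N%:R - j%:R) / (N%:R - i%:R) / N%:R).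
    rewrite /b /x !natrB// 1?ltnW//; field.
    by rewrite !gt_eqF.
  have jNR : 0 <= N%:R - j%:R :> R by rewrite subr_ge0 ler_nat.
  rewrite normrN ger0_norm; last by rewrite divr_ge0// divr_ge0 ?mulr_ge0// ltW.
  rewrite ler_wpM2r ?invr_ge0// ler_pdivrMr// -!natrB// 1?ltnW// -!natrM ler_nat.
  by nia.
have -> : (j ^_ i.+1)%:R / (N ^_ i.+1)%:R - (j%:R / N%:R) ^+ i.+1
   = A * (b - x) + (A - x ^+ i) * x.
  rewrite !ffactnSr !natrM exprSr -/x invfM mulrACA -/A -/b; ring.
rewrite (le_trans (ler_normD _ _))// (normrM A) (normrM _ x).
rewrite -natr1 mulrDl mul1r [leRHS]addrC lerD//.
  by rewrite -[leRHS]mul1r ler_pM// ger0_norm.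
rewrite -[leRHS]mulr1 ler_pM//; last by rewrite ger0_norm.
by apply: IH; exact: ltnW.
Qed.

(** The [j]-th Bernstein coefficient of [p] in degree [N] tends to [p.[j / N]] uniformly in [j], so
    the margin [e] makes all of them nonnegative for large [N]. *)
Lemma lfun_ge0 u p (e : R) :
  (forall m j, 0 <= lfun u ('X^j * (1 - 'X) ^+ m)) ->
  0 < e -> (forall x, 0 <= x <= 1 -> e <= p.[x]) -> 0 <= lfun u p.
Proof.
move=> cm e0 pe; pose d := size p.
pose S : R := \sum_(i < d) `|p`_i|.
have S0 : 0 <= S by apply: sumr_ge0.
(* The first summand meets the hypothesis of [ffact_ratio_dist]; the second pushes the total error,
   at most S * d * 2d / N, below [e]. *)
pose N := (2 * d + (Num.truncn (S * d%:R * (2 * d%:R) / e)).+1)%N.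
have N0 : (0 < N)%N by rewrite /N addnS.
have dN : (2 * d <= N)%N by apply: leq_addr.
have NS : S * (d%:R * (2 * d%:R / N%:R)) <= e.
  rewrite !mulrA ler_pdivrMr ?ltr0n// [e * _]mulrC -ler_pdivrMr//.
  rewrite !mulrA in N N0 dN *; apply: le_trans (ltW (truncnS_gt _)) _.
  by rewrite ler_nat leq_addl.
pose a (j : nat) : R := \sum_(i < d) p`_i * ((j ^_ i)%:R / (N ^_ i)%:R).
have a0 (j : 'I_N.+1) : 0 <= a j.
  have jN : (j <= N)%N by rewrite -ltnS.
  pose x : R := j%:R / N%:R.
  have x01 : 0 <= x <= 1 by rewrite divr_ge0//= ler_pdivrMr ?ltr0n// mul1r ler_nat.
  have : `|a j - p.[x]| <= e.
    apply: le_trans NS; rewrite horner_coef -sumrB (le_trans (ler_norm_sum _ _ _))//.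
    rewrite mulr_suml; apply: ler_sum => i _; rewrite -mulrBr normrM ler_wpM2l//.
    apply: le_trans (ffact_ratio_dist (ltnW (ltn_ord i)) dN N0 jN) _.
    by rewrite ler_wpM2r ?divr_ge0 ?mulr_ge0// ler_nat ltnW.
  by have := pe _ x01; rewrite ler_norml => ? /andP[? _]; lra.
have -> : p = \sum_(j < N.+1) (a j * 'C(N, j)%:R) *: ('X^j * (1 - 'X) ^+ (N - j)).
  rewrite -{1}[p]coefK poly_def.
  under eq_bigr => i _.
    rewrite (@monomial_bernstein i N); last by have := ltn_ord i; rewrite -/d; lia.
    rewrite scaler_sumr; over.
  rewrite exchange_big/=; apply: eq_bigr => j _.
  by rewrite /a mulr_suml scaler_suml; apply: eq_bigr => i _; rewrite scalerA !mulrA.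
rewrite linear_sum sumr_ge0// => j _.
by rewrite linearZ/= mulr_ge0// mulr_ge0.
Qed.

(** By compactness [p] has a positive minimum on [0, 1]. Subtracting half of it leaves room for
    [lfun_ge0], and the constant removed contributes a positive multiple of [u 0]. *)
Lemma lfun_gt0 u p :
  (forall m j, 0 <= lfun u ('X^j * (1 - 'X) ^+ m)) -> 0 < u 0%N ->
  (forall x, 0 <= x <= 1 -> 0 < p.[x]) -> 0 < lfun u p.
Proof.
move=> cm u0 pp.
have [] := @EVT_min R (fun x => p.[x]) 0 1 ler01.
  by apply: continuous_subspaceT => x; exact: continuous_horner.
move=> c c01 pc; pose e := p.[c] / 2.
have e0 : 0 < e by rewrite divr_gt0// pp// -in_itv.
have : 0 <= lfun u (p - e%:P).
  apply: (lfun_ge0 cm e0) => x x01; rewrite hornerD hornerN hornerC.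
  have := pc x; rewrite in_itv/= x01 => /(_ isT); rewrite /e; lra.
rewrite linearB/= lfunC; have := mulr_gt0 e0 u0; lra.
Qed.

End Bernstein.

(** * Toeplitz forms and predictors *)

(** The distance |i - j|: at most one of the truncated differences is nonzero. *)
Definition ndist (i j : nat) : nat := (i - j + (j - i))%N.

Lemma ndistC i j : ndist i j = ndist j i.
Proof. exact: addnC. Qed.

Section Toeplitz.
Context {R : realType}.
Implicit Types (r : nat -> R) (p q : {poly R}).

(** The bilinear form of the Toeplitz matrix of [r]; for an autocovariance [r], the covariance of
    the combinations of noise values with coefficients [p] and [q]. *)
Definition tform r p q : R := lfun (fun j => lfun (fun i => r (ndist i j)) p) q.

Lemma tformC r p q : tform r p q = tform r q p.
Proof.
rewrite /tform /lfun; under eq_bigr do rewrite mulr_sumr.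
rewrite exchange_big/=; apply: eq_bigr => i _; rewrite mulr_sumr.
by apply: eq_bigr => j _; rewrite mulrCA ndistC.
Qed.

Lemma tform_linear r p : linear (tform r p).
Proof. by move=> a q1 q2; rewrite /tform linearP. Qed.

HB.instance Definition _ r p :=
  GRing.isLinear.Build R {poly R} R _ (tform r p) (tform_linear r p).

Lemma tformBl r p1 p2 q : tform r (p1 - p2) q = tform r p1 q - tform r p2 q.
Proof. by rewrite ![tform r _ q]tformC linearB. Qed.

Lemma tformZl r a p q : tform r (a *: p) q = a * tform r p q.
Proof. by rewrite ![tform r _ q]tformC linearZ. Qed.

Lemma tform_suml r (I : Type) (s : seq I) (f : I -> {poly R}) q :
  tform r (\sum_(i <- s) f i) q = \sum_(i <- s) tform r (f i) q.
Proof. by rewrite tformC linear_sum; apply: eq_bigr => i _; rewrite tformC. Qed.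

Lemma tformXn r i j : tform r 'X^i 'X^j = r (ndist i j).
Proof. by rewrite /tform !lfunXn. Qed.

(** Stationarity: multiplication by ['X] is a time shift, hence an isometry. *)
Lemma tformMX r p q : tform r (p * 'X) (q * 'X) = tform r p q.
Proof.
rewrite /tform lfunMX; apply: eq_lfun => j _; rewrite lfunMX.
by apply: eq_lfun => i _; rewrite /ndist !subSS.
Qed.

Lemma tform1MX r p : tform r 1 (p * 'X) = lfun (fun i => r i.+1) p.
Proof.
rewrite /tform lfunMX; apply: eq_lfun => j _.
by rewrite -(expr0 'X) lfunXn /ndist sub0n subn0.
Qed.

Lemma tform_orthMX r p n :
  (forall j, (0 < j < n)%N -> tform r p 'X^j = 0) ->
  forall q, (size q < n)%N -> tform r p (q * 'X) = 0.
Proof.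
move=> orth q qn; rewrite -[q]coefK poly_def mulr_suml linear_sum big1// => i _.
rewrite -scalerAl linearZ/= -exprSr orth ?scaler0//=.
exact: leq_ltn_trans (ltn_ord i) qn.
Qed.

(* If p = ('X - x) q then <p, 'X q> = 0 reads <q, q> = x <q, 'X q>, which
   contradicts Cauchy-Schwarz since 'X acts isometrically. *)
Lemma orth_no_root r p n x :
  (forall q, q != 0 -> 0 < tform r q q) ->
  p`_0 = 1 -> (size p <= n)%N ->
  (forall j, (0 < j < n)%N -> tform r p 'X^j = 0) ->
  0 < x <= 1 -> p.[x] != 0.
Proof.
move=> pd p0 pn orth /andP[x0 x1]; apply/eqP => /eqP/factor_theorem[q pq].
have pN0 : p != 0 by apply/eqP => pE; move/eqP: p0; rewrite pE coef0 eq_sym oner_eq0.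
have qN0 : q != 0 by apply: contraNneq pN0; rewrite pq => ->; rewrite mul0r.
have qn : (size q < n)%N.
  by apply: leq_trans pn; rewrite pq size_Mmonic ?monicXsubC// size_XsubC addn2.
have := tform_orthMX orth qn.
have -> : p = q * 'X - x *: q by rewrite pq mulrBr -mul_polyC mulrC [q * _]mulrC; ring.
rewrite tformBl tformZl tformMX => /eqP; rewrite subr_eq0 => /eqP E.
have : 0 < tform r (q - q * 'X) (q - q * 'X).
  apply: pd; rewrite -{1}[q]mulr1 -mulrBr mulf_neq0// -size_poly_eq0.
  by rewrite -opprB size_polyN size_XsubC.
rewrite tformBl !linearB/= tformMX [tform r (q * 'X) q]tformC.
have := pd _ qN0; nra.
Qed.

(** Since [p.[0] = 1], a nonpositive value would give a root in (0, 1] by the intermediate value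
    theorem, against [orth_no_root]. *)
Lemma orth_pos r p n :
  (forall q, q != 0 -> 0 < tform r q q) ->
  p`_0 = 1 -> (size p <= n)%N ->
  (forall j, (0 < j < n)%N -> tform r p 'X^j = 0) ->
  forall x, 0 <= x <= 1 -> 0 < p.[x].
Proof.
move=> pd p0 pn orth x /andP[x0 x1].
have h0 : p.[0] = 1 by rewrite horner_coef0.
rewrite ltNge; apply/negP => px.
have [|y] := @poly_ivt _ (- p) 0 x x0; first by rewrite !hornerN h0; lra.
move=> /andP[y0 yx] /rootP; rewrite hornerN => /eqP; rewrite oppr_eq0 => /eqP py.
have yN0 : y != 0 by apply/eqP => yE; move/eqP: py; rewrite yE h0 oner_eq0.
have := @orth_no_root r p n y pd p0 pn orth.
by rewrite py eqxx lt0r yN0 y0 (le_trans yx x1) => /(_ isT).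
Qed.

(* G k multiplies the past value at distance k - 1, so that k runs from 2 as in
   the paper. *)
Definition predictor (G : nat -> R) n : {poly R} :=
  1 - \sum_(2 <= k < n.+1) G k *: 'X^(k.-1).

Lemma coef0_predictor G n : (predictor G n)`_0 = 1.
Proof.
rewrite coefB coef1 coef_sum big_nat big1 ?subr0// => k /andP[k2 _].
by rewrite coefZ coefXn; case: k k2 => [|[]]//= k _; rewrite mulr0.
Qed.

Lemma size_predictor G n : (0 < n)%N -> (size (predictor G n) <= n)%N.
Proof.
move=> n0; rewrite (leq_trans (size_polyD _ _))// geq_max size_poly1 n0 size_polyN/=.
rewrite big_nat; apply: (big_ind (fun p : {poly R} => (size p <= n)%N)).
- by rewrite size_poly0.
- by move=> p q pn qn; rewrite (leq_trans (size_polyD _ _))// geq_max pn.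
- move=> k /andP[k2 kn]; rewrite (leq_trans (size_scale_leq _ _))// size_polyXn.
  by case: k k2 kn => [|k].
Qed.

(** The normal equation at [l = j + 1] is orthogonality to ['X^j], all exponents being indices minus
    one. *)
Lemma predictor_orth r G n :
  (forall l, (2 <= l <= n)%N ->
     \sum_(2 <= k < n.+1) G k * r (ndist k l) = r (ndist 1 l)) ->
  forall j, (0 < j < n)%N -> tform r (predictor G n) 'X^j = 0.
Proof.
move=> E j /andP[j0 jn]; rewrite tformBl tform_suml -(expr0 'X) tformXn.
have := E j.+1; rewrite !ltnS j0 jn => /(_ isT); rewrite {2}/ndist !subSS -/(ndist 0 j) => <-.
rewrite -sumrB big_nat big1// => k /andP[k2 _].
by rewrite tformZl tformXn; case: k k2 => //= k _; rewrite /ndist !subSS subrr.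
Qed.

(* With p, p' the predictors on n - 1 and n past values, <p', 'X p> = 0 reads
   G' 2 <p, p> = <1, 'X p> = lfun (r \o S) p. *)
Lemma predictor_coef2_gt0 r (G G' : nat -> R) n : (0 < n)%N ->
  (forall q, q != 0 -> 0 < tform r q q) ->
  (forall m j, 0 <= lfun (fun i => r i.+1) ('X^j * (1 - 'X) ^+ m)) -> 0 < r 1%N ->
  (forall l, (2 <= l <= n)%N ->
     \sum_(2 <= k < n.+1) G k * r (ndist k l) = r (ndist 1 l)) ->
  (forall l, (2 <= l <= n.+1)%N ->
     \sum_(2 <= k < n.+2) G' k * r (ndist k l) = r (ndist 1 l)) ->
  0 < G' 2%N.
Proof.
move=> n0 pd cm r1 E E'; pose p := predictor G n.
have orth := predictor_orth E.
have ps := size_predictor G n0.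
have p0 := coef0_predictor G n.
have pN0 : p != 0 by apply/eqP => pE; move/eqP: p0; rewrite -/p pE coef0 eq_sym oner_eq0.
have L0 : 0 < lfun (fun i => r i.+1) p.
  by apply: lfun_gt0 => //; exact: orth_pos pd p0 ps orth.
(* [1 - p] is a combination of ['X], ..., ['X^(n - 1)], all orthogonal to [p]. *)
have p1 : tform r p 1 = tform r p p.
  rewrite {3}/p/predictor linearB/= (_ : tform r p (\sum_(_ <= _ < _) _) = 0) ?subr0//.
  rewrite linear_sum big_nat big1// => k /andP[k2 kn].
  by rewrite linearZ/= orth ?scaler0//; case: k k2 kn => [|[|k]]//=.
have := tform_orthMX (predictor_orth E') (_ : size p < n.+1)%N.
rewrite ltnS => /(_ ps); rewrite tformBl tform1MX tform_suml.
(* For [k >= 3], cancelling one ['X] turns the [k]-th term into a pairing of [p] with ['X^(k - 2)],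
   where 1 <= k - 2 < n, so only [k = 2] survives. *)
rewrite big_ltn// big_nat big1 ?addr0; last first.
  move=> [|[|[|k]]]//= kn; rewrite tformZl exprSr tformMX tformC orth ?mulr0//.
rewrite tformZl -[X in tform r X (p * _)]mul1r tformMX tformC p1 => /eqP.
rewrite subr_eq0 => /eqP Lp; rewrite Lp in L0.
by rewrite pmulr_lgt0 ?pd// in L0.
Qed.

End Toeplitz.

(** * Positive definiteness of convex kernels *)

Section Polya.
Context {R : realType}.
Implicit Types (r : nat -> R) (p q : {poly R}).

Lemma ndist_lt i j n : (i < n)%N -> (j < n)%N -> (ndist i j < n)%N.
Proof. by rewrite /ndist; lia. Qed.

Lemma eq_tform r r' p : (forall k, (k < size p)%N -> r k = r' k) ->
  tform r p p = tform r' p p.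
Proof.
move=> rr; apply: eq_lfun => j jp; apply: eq_lfun => i ip.
by rewrite rr// ndist_lt.
Qed.

Lemma tform_kernelD r r' p q :
  tform (fun k => r k + r' k) p q = tform r p q + tform r' p q.
Proof.
rewrite /tform /lfun -big_split/=; apply: eq_bigr => j _.
by rewrite -mulrDr -big_split/=; congr (_ * _); apply: eq_bigr => i _; rewrite mulrDr.
Qed.

Lemma tform_kernel_sum (I : Type) (s : seq I) (c : I -> R) (f : I -> nat -> R) p q :
  tform (fun k => \sum_(i <- s) c i * f i k) p q = \sum_(i <- s) c i * tform (f i) p q.
Proof.
rewrite /tform -lfun_sum_seq; apply: eq_lfun => j _.
by rewrite -lfun_sum_seq.
Qed.

Lemma tform_kernelZ c r p q : tform (fun k => c * r k) p q = c * tform r p q.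
Proof.
have := tform_kernel_sum [:: tt] (fun=> c) (fun=> r) p q.
rewrite big_seq1 => <-; rewrite /tform.
by apply: eq_lfun => j _; apply: eq_lfun => i _; rewrite big_seq1.
Qed.

Lemma tform_gram r p S (b : nat -> nat -> R) :
  (forall i j, (i < size p)%N -> (j < size p)%N ->
     r (ndist i j) = \sum_(0 <= s < S) b s j * b s i) ->
  tform r p p = \sum_(0 <= s < S) lfun (b s) p ^+ 2.
Proof.
move=> E; under [RHS]eq_bigr do rewrite expr2.
rewrite /tform; under eq_lfun => j jp.
  under eq_lfun => i ip do rewrite E//.
  rewrite lfun_sum_seq.
  under eq_bigr do rewrite mulrC; over.
by rewrite lfun_sum_seq.
Qed.

Lemma sum_itv_indicator (a b S : nat) : (b <= S)%N ->
  (\sum_(0 <= s < S) (a <= s < b) = b - a)%N.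
Proof.
move=> bS; suff : (\sum_(0 <= s < S) (a <= s < b) = minn S b - a)%N by lia.
by elim: S {bS} => [|S IH]; rewrite ?big_nil ?big_nat_recr//= ?IH; lia.
Qed.

(** The triangle counts the overlap of the windows of length [m] starting at [i] and [j], which
    exhibits it as a Gram matrix. *)
Lemma triangle_indicator (m i j S : nat) : (i + m <= S)%N ->
  (m - ndist i j = \sum_(0 <= s < S) (j <= s < j + m) * (i <= s < i + m))%N.
Proof.
move=> iS; transitivity (\sum_(0 <= s < S) (maxn i j <= s < minn i j + m))%N.
  by rewrite sum_itv_indicator /ndist; lia.
by apply: eq_bigr => s _; lia.
Qed.

Lemma tform_triangle_ge0 m p : 0 <= tform (fun k => (m - k)%:R) p p.
Proof.
rewrite (@tform_gram _ p (size p + m) (fun s i => (i <= s < i + m)%:R)).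
  by apply: sumr_ge0 => s _; exact: sqr_ge0.
move=> i j ip jp; rewrite (@triangle_indicator _ i j (size p + m)); last by lia.
by rewrite natr_sum; apply: eq_bigr => s _; rewrite natrM.
Qed.

(** By truncation [1 - k] vanishes for [k >= 1], so the triangle of width 1 is the identity
    matrix. *)
Lemma tform_triangle1 p : tform (fun k => (1 - k)%:R) p p = \sum_(0 <= s < size p) p`_s ^+ 2.
Proof.
rewrite (@tform_gram _ p (size p) (fun s i => (i == s)%:R)).
  rewrite big_nat [RHS]big_nat; apply: eq_bigr => s /andP[_ sp]; congr (_ ^+ 2).
  rewrite /lfun (bigD1 (Ordinal sp))//= eqxx mulr1 big1 ?addr0// => i.
  by rewrite -val_eqE/= => /negPf ->; rewrite mulr0.
move=> i j ip jp; rewrite (@triangle_indicator _ i j (size p)); last by lia.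
rewrite natr_sum; apply: eq_bigr => s _; rewrite natrM.
by congr (_%:R * _%:R); lia.
Qed.

Lemma tform_const_ge0 p : 0 <= tform (fun=> 1) p p.
Proof.
rewrite (@tform_gram _ p 1 (fun _ _ => 1)); first by rewrite big_nat1 sqr_ge0.
by move=> i j _ _; rewrite big_nat1 mulr1.
Qed.

(** Second differences are summed twice down from the index [k + n]. Terms with [m < k] vanish by
    truncation, so for fixed [k + n] the weights do not depend on [k]. *)
Lemma convex_triangle_decomposition r k n :
  r k = \sum_(0 <= m < k + n) (r m - 2 * r m.+1 + r m.+2) * (m.+1 - k)%:R
        + (r (k + n)%N - r (k + n).+1) * ((k + n).+1 - k)%:R + r (k + n).+1.
Proof.
elim: n => [|n IH].
  rewrite addn0 big_nat big1 ?subSnn//; first ring.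
  by move=> m /andP[_ mk]; rewrite (eqP (mk : (m.+1 - k == 0)%N)) mulr0.
rewrite {1}IH addnS big_nat_recr//=.
have -> : ((k + n).+2 - k = ((k + n).+1 - k).+1)%N by lia.
rewrite -natr1; ring.
Qed.

(* Discrete Polya criterion: a convex sequence that decreases to a nonnegative
   limit is a nonnegative combination of triangles, i.e. of Fejer kernels. *)
Lemma polya r :
  0 < r 0%N - 2 * r 1%N + r 2%N ->
  (forall m, 0 <= r m.+1 - 2 * r m.+2 + r m.+3) ->
  (forall m, r m.+2 <= r m.+1) -> (forall m, 0 <= r m.+1) ->
  forall p, p != 0 -> 0 < tform r p p.
Proof.
move=> c0 c1 dec r0 p pN0; pose N := size p.
have N0 : (0 < N)%N by rewrite size_poly_gt0.
pose c m := r m - 2 * r m.+1 + r m.+2.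
rewrite (@eq_tform _ (fun k => \sum_(0 <= m < N) c m * (m.+1 - k)%:R
        + (r N - r N.+1) * (N.+1 - k)%:R + r N.+1 * 1)); last first.
  move=> k /ltnW kN; have := convex_triangle_decomposition r k (N - k).
  by rewrite subnKC// mulr1.
rewrite !tform_kernelD !tform_kernelZ tform_kernel_sum.
(* Strictness comes from [m = 0] alone: its kernel is the identity and the leading coefficient of
   [p] is nonzero. *)
rewrite big_ltn// tform_triangle1 -!addrA ltr_pwDl//.
  rewrite mulr_gt0// -/N -(prednK N0) big_nat_recr//= ltr_wpDl//.
    by apply: sumr_ge0 => s _; exact: sqr_ge0.
  by rewrite exprn_even_gt0//= -lead_coefE lead_coef_eq0.
rewrite !addr_ge0// ?mulr_ge0// ?tform_triangle_ge0 ?tform_const_ge0//.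
- rewrite big_nat sumr_ge0// => -[//|m] _.
  by rewrite mulr_ge0 ?tform_triangle_ge0// /c.
- by case: N N0 => // n _; rewrite subr_ge0.
Qed.

End Polya.

(** * Autocovariance of fractional Gaussian noise *)

Section Differences.
Context {R : realType}.
Implicit Types (f : R -> R) (t : R).

(** The operator (1 - shift)^m, i.e. (-1)^m times the forward difference, so that complete
    monotonicity means nonnegative values. *)
Fixpoint fdiff m f t : R :=
  if m is m'.+1 then fdiff m' f t - fdiff m' f (t + 1) else f t.

Lemma fdiff_scale m k f t : fdiff m (fun x => k * f x) t = k * fdiff m f t.
Proof. by elim: m t => //= m IH t; rewrite !IH mulrBr. Qed.

(** Multiplication by ['X] shifts the sequence, so each factor [1 - 'X] takes one more
    difference. *)
Lemma fdiff_lfun m n f t j :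
  lfun (fun i => fdiff n f (t + i%:R)) ('X^j * (1 - 'X) ^+ m) =
  fdiff (n + m) f (t + j%:R).
Proof.
elim: m j => [|m IH] j; first by rewrite expr0 mulr1 lfunXn addn0.
rewrite exprSr mulrA mulrBr mulr1 linearB/= IH addnS /=; congr (_ - _).
by rewrite mulrAC -exprSr IH -natr1 addrA.
Qed.

Lemma fdiff_is_derive m f f' t :
  (forall x, t < x -> is_derive x 1 f (f' x)) ->
  forall x, t < x -> is_derive x 1 (fdiff m f) (fdiff m f' x).
Proof.
move=> df; elim: m => [|m IH] x tx /=; first exact: df.
have tx1 : t < x + 1 by lra.
have d0 := IH _ tx; have d1 := IH _ tx1.
have ds : is_derive x 1 (fun y : R => y + 1) (1 : R) by exact: is_derive_shift.
have dc := @is_derive1_comp R (fdiff m f) (fun y => y + 1) x _ _ d1 ds.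
have := is_deriveB d0 dc; rewrite mulr1; exact.
Qed.

Lemma fdiff_continuous m f t :
  (forall x, t <= x -> {for x, continuous f}) ->
  forall x, t <= x -> {for x, continuous (fdiff m f)}.
Proof.
move=> cf; elim: m => [|m IH] x tx /=; first exact: cf.
apply: continuousB; first exact: IH.
apply: (@continuous_comp _ _ _ (fun y : R => y + 1) (fdiff m f)).
  by apply: continuousD => //; exact: cvg_cst.
by apply: IH; lra.
Qed.

(** The mean value theorem for [fdiff m f] on [t, t + 1] trades a difference for a derivative.
    Differentiability only beyond [t] lets powers be treated from [t = 0] on. *)
Lemma fdiff_mvt m f f' t :
  (forall x, t < x -> is_derive x 1 f (f' x)) ->
  (forall x, t <= x -> {for x, continuous f}) ->
  exists2 c, t < c & fdiff m.+1 f t = - fdiff m f' c.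
Proof.
move=> df cf; have t1 : t < t + 1 by rewrite ltrDl.
have [||c] := @MVT R (fdiff m f) (fdiff m f') t (t + 1) t1.
- by move=> x; rewrite in_itv/= => /andP[tx _]; exact: fdiff_is_derive df _ tx.
- apply/continuous_within_itvP => //; split.
  + move=> x; rewrite in_itv/= => /andP[/ltW tx _]; exact: fdiff_continuous cf _ tx.
  + by apply: cvg_at_right_filter; exact: fdiff_continuous cf _ (lexx t).
  + by apply: cvg_at_left_filter; exact: fdiff_continuous cf _ (ltW t1).
rewrite in_itv/= => /andP[tc _] E; exists c => //=.
by rewrite -opprB E; lra.
Qed.

(** Each mean value step brings out a factor [- c >= 0] and lowers the exponent to [c - 1], again
    nonpositive. *)
Lemma fdiff_powR_neg m (c : R) t : c <= 0 -> 0 < t -> 0 <= fdiff m (fun x : R => x `^ c) t.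
Proof.
elim: m c t => [|m IH] c t c0 t0 /=; first exact: powR_ge0.
have [||x tx] := @fdiff_mvt m (fun x : R => x `^ c) (fun x => c * x `^ (c - 1)) t.
- by move=> x tx; apply: is_derive1_powR; lra.
- move=> x tx; apply/differentiable_continuous/derivable1_diffP.
  by apply: derivable_powR; rewrite in_itv/= andbT; lra.
move=> /= ->; rewrite fdiff_scale -mulNr mulr_ge0 ?oppr_ge0//.
by apply: IH; lra.
Qed.

Lemma fdiff_powR_frac m (c : R) t : 0 <= c <= 1 -> 0 < t -> fdiff m.+1 (fun x : R => x `^ c) t <= 0.
Proof.
move=> /andP[c0 c1] t0.
have [||x tx ->] := @fdiff_mvt m (fun x : R => x `^ c) (fun x => c * x `^ (c - 1)) t.
- by move=> x tx; apply: is_derive1_powR; lra.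
- move=> x tx; apply/differentiable_continuous/derivable1_diffP.
  by apply: derivable_powR; rewrite in_itv/= andbT; lra.
by rewrite fdiff_scale oppr_le0 mulr_ge0// fdiff_powR_neg; lra.
Qed.

Lemma is_derive_normr_powR (a x : R) : 0 < x ->
  is_derive x 1 (fun y => `|y| `^ a) (a * x `^ (a - 1)).
Proof.
move=> x0; have [d e] := is_derive1_powR a x0.
have E : {near x, (fun y : R => y `^ a) =1 (fun y => `|y| `^ a)}.
  by near=> y; rewrite gtr0_norm//; near: y; exact: lt_nbhsr.
split; first exact: near_eq_derivable d.
by rewrite -e; apply: near_eq_derive => //; near do apply/esym.
Unshelve. all: by end_near.
Qed.

(** Continuity at 0 is two-sided; the absolute value makes the left side behave like the right
    one. *)
Lemma continuous_normr_powR (a x : R) : 0 < a -> 0 <= x ->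
  {for x, continuous (fun y => `|y| `^ a)}.
Proof.
move=> a0; rewrite le_eqVlt => /predU1P[<-|x0]; last first.
  apply/differentiable_continuous/derivable1_diffP.
  by case: (is_derive_normr_powR a x0).
apply/cvgrPdist_lt => e e0; near=> y.
rewrite normr0 powR0 ?gt_eqF// sub0r normrN ger0_norm ?powR_ge0//.
have -> : e = (e `^ a^-1) `^ a by rewrite -powRrM mulVf ?gt_eqF// powRr1// ltW.
rewrite gt0_ltr_powR// ?nnegrE ?powR_ge0//.
near: y; exists (e `^ a^-1); first exact: powR_gt0.
by move=> y /=; rewrite sub0r normrN.
Unshelve. all: by end_near.
Qed.

(** Two mean value steps bring the exponent down to [a - 2 <= 0] with factors [a] and [a - 1], and
    their two minus signs cancel. *)
Lemma fdiff_powR_ge0 m (a : R) t : 1 < a < 2 -> 0 <= t -> 0 <= fdiff m.+2 (fun y => `|y| `^ a) t.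
Proof.
move=> /andP[a1 a2] t0.
have [||x tx ->] := @fdiff_mvt m.+1 (fun y => `|y| `^ a) (fun x => a * x `^ (a - 1)) t.
- by move=> x tx; apply: is_derive_normr_powR; lra.
- by move=> x tx; apply: continuous_normr_powR; lra.
rewrite fdiff_scale oppr_ge0 mulr_ge0_le0//; first lra.
by apply: fdiff_powR_frac; lra.
Qed.

End Differences.

Definition fgn_autocov {R : realType} (H : R) (k : nat) : R :=
  2^-1 * (k.+1%:R `^ (2 * H) - 2 * k%:R `^ (2 * H) + `|k%:R - 1| `^ (2 * H)).

(** * Monotonicity and positive definiteness of the autocovariance *)

Section FractionalNoiseAutocovariance.
Context {R : realType}.
Variable H : R.
Hypotheses (hH : 2^-1 < H) (hH1 : H < 1).

Local Notation g := (fun x : R => `|x| `^ (2 * H)).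

Let twoH_gt1 : 1 < 2 * H.
Proof. by rewrite mulrC -ltr_pdivrMr// mul1r. Qed.

Let twoH_neq0 : 2 * H != 0.
Proof. by rewrite gt_eqF// (lt_trans _ twoH_gt1). Qed.

(** From lag 1 on, the second difference runs over the nonnegative points k, k + 1, k + 2; lag 0
    straddles the origin and is treated apart. *)
Lemma fgn_autocovS k : fgn_autocov H k.+1 = 2^-1 * fdiff 2 g k%:R.
Proof.
rewrite /fgn_autocov /=.
have -> : k.+1%:R - 1 = k%:R :> R by rewrite -natr1 addrK.
by rewrite -addrA !natr1 !ger0_norm//; ring.
Qed.

Let fdiff_ge0 m k : 0 <= 2^-1 * fdiff m.+2 g k%:R.
Proof.
rewrite mulr_ge0// fdiff_powR_ge0//.
by rewrite twoH_gt1 gtr_pMr.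
Qed.

Lemma fgn_autocovS_ge0 k : 0 <= fgn_autocov H k.+1.
Proof. by rewrite fgn_autocovS. Qed.

Lemma fgn_autocovS_decreasing k : fgn_autocov H k.+2 <= fgn_autocov H k.+1.
Proof.
rewrite -subr_ge0 !fgn_autocovS -mulrBr -[k.+1%:R]natr1.
exact: (fdiff_ge0 1).
Qed.

Lemma fgn_autocovS_convex k :
  0 <= fgn_autocov H k.+1 - 2 * fgn_autocov H k.+2 + fgn_autocov H k.+3.
Proof.
have := fdiff_ge0 2 k; congr (_ <= _).
rewrite !fgn_autocovS -[k.+2%:R]natr1 -[k.+1%:R]natr1 /=; ring.
Qed.

Lemma fgn_autocovS_monotone m j :
  0 <= lfun (fun i => fgn_autocov H i.+1) ('X^j * (1 - 'X) ^+ m).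
Proof.
have -> : lfun (fun i => fgn_autocov H i.+1) ('X^j * (1 - 'X) ^+ m) =
    2^-1 * lfun (fun i => fdiff 2 g (0 + i%:R)) ('X^j * (1 - 'X) ^+ m).
  rewrite /lfun mulr_sumr; apply: eq_bigr => i _.
  by rewrite fgn_autocovS add0r mulrCA.
by rewrite fdiff_lfun add0r; exact: fdiff_ge0.
Qed.

Lemma fgn_autocov0 : fgn_autocov H 0 = 1.
Proof. by rewrite /fgn_autocov sub0r normrN normr1 powR1 powR0//; field.
Qed.

Lemma fgn_autocov1_gt0 : 0 < fgn_autocov H 1.
Proof.
rewrite /fgn_autocov subrr normr0 powR0//.
rewrite powR1 mulr1 addr0 mulr_gt0// subr_gt0.
rewrite (_ : 2 * H = 1 + (2 * H - 1)); last by ring.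
rewrite powRD ?pnatr_eq0 ?implybT// powRr1// ltr_pMr//.
by rewrite /powR pnatr_eq0/= expR_gt1 mulr_gt0 ?ln_gt0 ?ltr1n// subr_gt0.
Qed.

(* With b = 2 - 2H, convexity of exp gives
   (9 * 3 ^ -b + 7) / 16 >= 3 ^ (- 9 b / 16), and 3 ^ 9 < 2 ^ 16. *)
Lemma fgn_autocov_convex0 :
  0 < fgn_autocov H 0 - 2 * fgn_autocov H 1 + fgn_autocov H 2.
Proof.
pose b := 2 - 2 * H; have b0 : 0 < b by rewrite /b; move: hH1; lra.
(* The quantity to bound is (7 + 9 * 3 ^ -b - 16 * 2 ^ -b) / 2, and [y] is the mean of
   [- (b * ln 3)] and 0 with weights 9/16 and 7/16. *)
pose y := - (b * ln 3) * 9 / 16.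
have ln23 : 9 * ln 3 < 16 * ln 2 :> R.
  rewrite !mulr_natl -!lnXn// ltr_ln ?posrE ?exprn_gt0//.
  by rewrite -!natrX ltr_nat.
have powE (c : R) : 0 < c -> c `^ (2 * H) = c ^+ 2 * expR (- (b * ln c)).
  move=> c0; rewrite (_ : 2 * H = 2 - b); last by rewrite /b; ring.
  rewrite powRB; last by rewrite (gt_eqF c0) implybT.
  rewrite powR_mulrn ?ltW//.
  by rewrite expRN /powR gt_eqF.
(* Convexity enters through the tangent at [y]: with weights 9 and 7 the linear terms cancel. *)
have tangent x : expR y * (1 + (x - y)) <= expR x.
  rewrite (_ : expR x = expR y * expR (x - y)); last by rewrite -expRD addrC subrK.
  by rewrite ler_wpM2l ?expR_ge0 ?expR_ge1Dx.
have e1 := tangent (- (b * ln 3)).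
have e2 := tangent 0; rewrite expR0 in e2.
have e3 : expR (- (b * ln 2)) < expR y by rewrite ltr_expR /y; nra.
rewrite fgn_autocov0 /fgn_autocov subrr normr0 powR0//.
rewrite powR1 (_ : 2 - 1 = 1)//; last by ring.
rewrite normr1 powR1 !powE// /y in e1 e2 e3 *; nra.
Qed.

Lemma fgn_autocov_posdef p : p != 0 -> 0 < tform (fgn_autocov H) p p.
Proof.
apply: polya.
- exact: fgn_autocov_convex0.
- exact: fgn_autocovS_convex.
- exact: fgn_autocovS_decreasing.
- exact: fgn_autocovS_ge0.
Qed.

End FractionalNoiseAutocovariance.

(** * Normal equations *)

Section Orthogonality.
Context d (T : measurableType d) (R : realType).
Variable mu : {measure set T -> \bar R}.
Import HBNNSimple.

(** First stage of passing from events of [f] to [f] itself: [g] has finite range, so its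
    composition with [f] is a finite combination of indicators of such events. *)
Lemma integral_mul_simple (W f : T -> R) (g : {nnsfun R >-> R}) :
  mu.-integrable setT (EFin \o W) -> measurable_fun setT f ->
  (forall A : set R, measurable A -> (\int[mu]_(w in f @^-1` A) (W w)%:E = 0)%E) ->
  (\int[mu]_w (W w * g (f w))%:E = 0)%E.
Proof.
move=> iW mf W0.
have gE w : (W w * g (f w))%:E =
    (\sum_(y <- fset_set (range g)) y%:E * ((EFin \o W) \_ (f @^-1` (g @^-1` [set y]))) w)%E.
  rewrite [g (f w)]fimfunE fsbig_finite//= mulr_sumr -sumEFin.
  apply: eq_bigr => y _; rewrite patchE indicE.
  have -> : (w \in f @^-1` (g @^-1` [set y])) = (f w \in g @^-1` [set y]).
    by apply/idP/idP; rewrite !inE.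
  by case: (f w \in _); rewrite -EFinM /= ?mulr1 ?mulr0 // mulrC.
have mS y : measurable (f @^-1` (g @^-1` [set y])).
  by rewrite -[X in measurable X]setTI; apply: mf.
have iS y : mu.-integrable setT ((EFin \o W) \_ (f @^-1` (g @^-1` [set y]))).
  by apply/integrable_restrict => //; rewrite setTI; apply: integrableS iW.
under eq_integral do rewrite gE.
rewrite integral_sum//=; last by move=> y; exact: integrableZl.
rewrite big1 // => y _.
by rewrite integralZl// -integral_mkcond /= W0 ?mule0.
Qed.

Lemma integral_mul_pos (W f : T -> R) :
  mu.-integrable setT (EFin \o W) -> measurable_fun setT f ->
  mu.-integrable setT (EFin \o (W \* f)) ->
  (forall A : set R, measurable A -> (\int[mu]_(w in f @^-1` A) (W w)%:E = 0)%E) ->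
  (\int[mu]_w (W w * f^\+ w)%:E = 0)%E.
Proof.
move=> iW mf iWf W0.
pose h := EFin \o (fun y : R => y)^\+.
have mh : measurable_fun [set: R] h.
  by apply/measurable_EFinP/measurable_funrpos.
have h0 y : setT y -> (0 <= h y)%E by move=> _; rewrite lee_fin funrpos_ge0.
(* Approximating on the real line and then composing with [f] keeps the approximants functions of
   [f]; the products are dominated by |W f|. *)
pose a n := nnsfun_approx measurableT mh n.
have mW : measurable_fun setT W by apply/measurable_EFinP; exact: measurable_int iW.
have mfp : measurable_fun setT f^\+ by exact: measurable_funrpos.
have [] := @dominated_convergence _ _ _ mu setT measurableT
  (fun n w => (W w * a n (f w))%:E) (fun w => (W w * f^\+ w)%:E)
  (fun w => `|(W w * f w)%:E|)%E.
- move=> n; apply/measurable_EFinP; apply: measurable_funM => //.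
  exact: (measurableT_comp _ mf).
- by apply/measurable_EFinP; apply: measurable_funM.
- apply/aeW => w _.
  have := @cvg_nnsfun_approx _ _ _ _ measurableT _ mh h0 (f w) I.
  move=> /fine_cvgP[_ /=]; rewrite /h /= => ac.
  apply/fine_cvgP; split; first by near=> n.
  rewrite /=; apply: cvgMr; exact: ac.
- exact: integrable_abse.
- apply/aeW => w n _ /=.
  rewrite lee_fin !normrM ler_wpM2l//.
  have := @le_approx _ _ _ setT h n (f w) h0 I.
  rewrite -nnsfun_approxE /h /= lee_fin => H.
  rewrite ger0_norm//; apply: le_trans H _.
  by rewrite /funrpos /= ge_max ler_norm normr_ge0.
move=> _ _.
under eq_fun do rewrite integral_mul_simple//.
by move/cvg_lim => <-//; rewrite lim_cst.
Unshelve. all: by end_near.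
Qed.

(** Split [f] into positive and negative parts; the events of [- f] are events of [f]. *)
Lemma integral_mul_eq0 (W f : T -> R) :
  mu.-integrable setT (EFin \o W) -> measurable_fun setT f ->
  mu.-integrable setT (EFin \o (W \* f)) ->
  (forall A : set R, measurable A -> (\int[mu]_(w in f @^-1` A) (W w)%:E = 0)%E) ->
  (\int[mu]_w (W w * f w)%:E = 0)%E.
Proof.
move=> iW mf iWf W0.
have mW : measurable_fun setT W by apply/measurable_EFinP; exact: measurable_int iW.
have iN : mu.-integrable setT (EFin \o (W \* (\- f))).
  have := integrableN iWf; congr (integrable _ _ _).
  by apply/funext => w /=; rewrite mulrN.
have mN : measurable_fun setT (\- f) by exact: measurableT_comp.
have WN0 (A : set R) : measurable A -> (\int[mu]_(w in (\- f)%R @^-1` A) (W w)%:E = 0)%E.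
  move=> mA; rewrite (_ : _ @^-1` A = f @^-1` (-%R @^-1` A))//.
  by apply: W0; rewrite -[X in measurable X]setTI; exact: (@oppr_measurable R setT).
have iP g : measurable_fun setT g -> mu.-integrable setT (EFin \o (W \* g)) ->
    mu.-integrable setT (EFin \o (W \* g^\+)).
  move=> mg; apply: le_integrable => //.
    by apply/measurable_EFinP; apply: measurable_funM => //; exact: measurable_funrpos.
  move=> w _ /=; rewrite lee_fin !normrM ler_wpM2l// ger0_norm ?funrpos_ge0//.
  by rewrite /funrpos ge_max ler_norm normr_ge0.
have E w : (W w * f w)%:E = ((W w * f^\+ w)%:E - (W w * (\- f)^\+ w)%:E)%E.
  rewrite -EFinB -mulrBr; congr (_ * _)%:E.
  exact/esym/(congr1 (@^~ w) (funrposBneg f)).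
under eq_integral do rewrite E.
rewrite integralB_EFin//=; [|exact: iP|exact: iP].
by rewrite !integral_mul_pos// sube0.
Qed.

End Orthogonality.

(** * Square-integrable variables and conditional expectation *)

Section SquareIntegrable.
Context d (T : measurableType d) (R : realType).

Lemma Lfun2_sqr_integrable (mu : {measure set T -> \bar R}) (f : T -> R) :
  measurable_fun setT f -> (\int[mu]_w (f w ^+ 2)%:E < +oo)%E ->
  f \in Lfun mu 2%:E.
Proof.
move=> mf foo; rewrite inE; apply/andP; split; rewrite inE//=.
rewrite /finite_norm unlock /=.
apply: poweR_lty.
apply: le_lt_trans foo; rewrite le_eqVlt; apply/orP; left; apply/eqP.
by apply: eq_integral => w _; rewrite powR_mulrn// real_normK// num_real.
Qed.

Lemma covariance_centered (P : probability T R) (X Y : T -> R) :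
  ('E_P[X] = 0)%E -> ('E_P[Y] = 0)%E ->
  covariance P X Y = (\int[P]_w (X w * Y w)%:E)%E.
Proof.
move=> X0 Y0; rewrite unlock X0 Y0 /= unlock.
by apply: eq_integral => w _; rewrite !fctE /= !subr0.
Qed.

(** [X - Z] integrates to zero over every event of [f], as these lie in [G]; square integrability
    makes the products integrable. *)
Lemma cond_expectation_orthogonal (P : probability T R) (G : set (set T))
    (X Z f : T -> R) :
  is_cond_expectation P G X Z ->
  X \in Lfun P 2%:E -> Z \in Lfun P 2%:E -> f \in Lfun P 2%:E ->
  G `<=` measurable ->
  (forall A : set R, measurable A -> G (f @^-1` A)) ->
  (\int[P]_w (Z w * f w)%:E = \int[P]_w (X w * f w)%:E)%E.
Proof.
move=> [iX iZ _ XZ] X2 Z2 f2 Gm Gf.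
have iM Y : Y \in Lfun P 2%:E -> P.-integrable setT (EFin \o (Y \* f)).
  by move=> Y2; apply/Lfun1_integrable/Lfun2_mul_Lfun1.
have mf : measurable_fun setT f.
  by move=> _ A mA; rewrite setTI; apply/Gm/Gf.
have /eqP : (\int[P]_w ((X \- Z) w * f w)%:E = 0)%E.
  apply: integral_mul_eq0 => //.
  - exact: (integrableB measurableT iX iZ).
  - by apply: iM; rewrite rpredB ?lee1n.
  move=> A mA; rewrite integralB_EFin//=.
  - rewrite -XZ ?subee//; last exact: Gf.
    apply: integrable_fin_num; first by apply/Gm/Gf.
    by apply: integrableS iZ => //; apply/Gm/Gf.
  - by apply/Gm/Gf.
  - by apply: integrableS iX => //; apply/Gm/Gf.
  - by apply: integrableS iZ => //; apply/Gm/Gf.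
under eq_integral do rewrite /= mulrBl EFinB.
rewrite integralB_EFin//=; [|exact: iM|exact: iM].
have fin Y : Y \in Lfun P 2%:E -> (\int[P]_w (Y w * f w)%:E)%E \is a fin_num.
  by move=> Y2; apply: integrable_fin_num (iM _ Y2).
by rewrite sube_eq ?add0e ?fin_num_adde_defl ?fin// => /eqP.
Qed.

End SquareIntegrable.

Lemma ndist_addl i k : ndist (i + k) i = k.
Proof. by rewrite /ndist addKn (eqP (leq_addr k i : i - (i + k) == 0)%N) addn0. Qed.

Definition fbm_cov {R : realType} (H s t : R) : R :=
  2^-1 * (s `^ (2 * H) + t `^ (2 * H) - `|s - t| `^ (2 * H)).

(** These are the four covariances met when expanding a product of two increments. The powers
    depending on [j] alone or on [j + k] cancel, which is stationarity. *)
Lemma fbm_cov_increments (R : realType) (H : R) (j k : nat) :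
  fbm_cov H (j + k).+1%:R j.+1%:R - fbm_cov H (j + k)%:R j.+1%:R
  - (fbm_cov H (j + k).+1%:R j%:R - fbm_cov H (j + k)%:R j%:R)
  = fgn_autocov H k.
Proof.
rewrite /fbm_cov /fgn_autocov.
have -> : (j + k).+1%:R - j.+1%:R = k%:R :> R by rewrite -!natr1 natrD; ring.
have -> : (j + k)%:R - j.+1%:R = k%:R - 1 :> R by rewrite -!natr1 natrD; ring.
have -> : (j + k).+1%:R - j%:R = k.+1%:R :> R by rewrite -!natr1 natrD; ring.
have -> : (j + k)%:R - j%:R = k%:R :> R by rewrite natrD; ring.
rewrite !(ger0_norm (ler0n _ _)); ring.
Qed.

(** * Covariances of the increments and normal equations *)

Section FractionalNoise.
Context d (T : measurableType d) (R : realType).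
Variables (P : probability T R) (H : R) (B : R -> {RV P >-> R}).
Hypothesis hB : fractional_brownian_motion H B.

Lemma fbm_covariance s t : 0 <= s -> 0 <= t ->
  (\int[P]_w (B s w * B t w)%:E = (fbm_cov H s t)%:E)%E.
Proof.
move=> s0 t0; have [_ E0 C] := hB.
by rewrite -covariance_centered ?E0// C.
Qed.

Lemma fbm_Lfun2 t : 0 <= t -> (B t : T -> R) \in Lfun P 2%:E.
Proof.
move=> t0; apply: Lfun2_sqr_integrable => //.
by under eq_integral do rewrite expr2; rewrite fbm_covariance// ltry.
Qed.

Lemma fgn_Lfun2 n : (fbm_increment B n : T -> R) \in Lfun P 2%:E.
Proof. by rewrite /fbm_increment rpredB ?lee1n// => ?; exact: fbm_Lfun2. Qed.

Lemma fgn_covariance i j : (0 < i)%N -> (0 < j)%N ->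
  (\int[P]_w (fbm_increment B i w * fbm_increment B j w)%:E =
   (fgn_autocov H (ndist i j))%:E)%E.
Proof.
wlog ij : i j / (j <= i)%N.
  move=> Hw i0 j0; have [|/ltnW] := leqP j i; first by move/Hw; exact.
  move/Hw => /(_ j0 i0); rewrite ndistC => <-.
  by apply: eq_integral => w _; rewrite mulrC.
have iM s t : 0 <= s -> 0 <= t -> P.-integrable setT (fun w => (B s w * B t w)%:E).
  by move=> s0 t0; apply/Lfun1_integrable/Lfun2_mul_Lfun1; exact: fbm_Lfun2.
case: i j ij => [//|i] [//|j]; rewrite ltnS => /subnKC <-; move: (i - j)%N => k _ _.
rewrite -addSn ndist_addl addSn -(fbm_cov_increments _ j).
transitivity (\int[P]_w ((B (j + k).+1%:R w * B j.+1%:R w - B (j + k)%:R w * B j.+1%:R w)%:E -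
   (B (j + k).+1%:R w * B j%:R w - B (j + k)%:R w * B j%:R w)%:E))%E.
  apply: eq_integral => w _; have dE n : fbm_increment B n w = B n%:R w - B n.-1%:R w by [].
  by rewrite !dE /= -EFinB; congr _%:E; ring.
have iB s t u : 0 <= s -> 0 <= t -> 0 <= u ->
  P.-integrable setT (fun w => (B s w * B u w - B t w * B u w)%:E).
  by move=> s0 t0 u0; exact: (integrableB measurableT (iM _ _ s0 u0) (iM _ _ t0 u0)).
rewrite integralB_EFin ?iB//.
under eq_integral do rewrite EFinB.
under [X in (_ - X)%E]eq_integral do rewrite EFinB.
rewrite !integralB_EFin ?iM//.
by rewrite !fbm_covariance// -!EFinB.
Qed.

Lemma fgn_sigma_measurable I :
  sigma_generated I (fbm_increment B) `<=` measurable.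
Proof.
apply: smallest_sub; first exact: sigma_algebra_measurable.
move=> A [k _ [C mC <-]]; exact: measurable_funP.
Qed.

(** Test the conditional expectation against the [l]-th increment, one of the conditioning
    variables, and expand by linearity. *)
Lemma fgn_normal_equations (Gamma : nat -> nat -> R) n l :
  projection_coefficients B Gamma -> (2 <= l <= n)%N ->
  \sum_(2 <= k < n.+1) Gamma n k * fgn_autocov H (ndist k l) =
  fgn_autocov H (ndist 1 l).
Proof.
move=> hG /andP[l2 ln].
have l0 : (0 < l)%N by apply: leq_trans l2.
pose Z w := \sum_(2 <= k < n.+1) Gamma n k * fbm_increment B k w.
have Z2 : Z \in Lfun P 2%:E.
  have -> : Z = \sum_(2 <= k < n.+1) Gamma n k *: (fbm_increment B k : T -> R).
    by apply/funext => w; rewrite fct_sumE.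
  have h12 : (1 <= 2%:E :> \bar R)%E by rewrite lee1n.
  have [L0 LD] := Lfun_submod_closed P h12.
  apply: (big_ind (fun Y => Y \in Lfun P 2%:E)) => // [X Y X2 Y2|k _].
    by rewrite -[X]scale1r; exact: LD.
  by rewrite -[_ *: _]addr0; apply: LD => //; exact: fgn_Lfun2.
have := cond_expectation_orthogonal (hG n (leq_trans l2 ln)) (fgn_Lfun2 1) Z2 (fgn_Lfun2 l).
rewrite fgn_covariance// => E.
apply: EFin_inj; rewrite -E; last 2 first.
- exact: fgn_sigma_measurable.
- move=> A mA; apply: sub_sigma_algebra; exists l; first by rewrite /= l2.
  by exists A => //; rewrite setTI.
under [RHS]eq_integral do rewrite /Z mulr_suml -sumEFin.
have iM k : P.-integrable setT (fun w => (fbm_increment B k w * fbm_increment B l w)%:E).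
  by apply/Lfun1_integrable/Lfun2_mul_Lfun1; exact: fgn_Lfun2.
under [RHS]eq_integral do under eq_bigr do rewrite -mulrA EFinM.
rewrite integral_sum//; last by move=> k; exact: integrableZl.
rewrite -sumEFin big_seq [RHS]big_seq; apply: eq_bigr => k; rewrite mem_index_iota.
move=> /andP[k2 _].
by rewrite integralZl// fgn_covariance// ltnW.
Qed.

End FractionalNoise.

Theorem proposition2p17 (R : realType) (d : measure_display)
    (T : measurableType d) (P : probability T R) (H : R)
    (B : R -> {RV P >-> R}) (Gamma : nat -> nat -> R)
    (hH : 2^-1 < H) (hH1 : H < 1)
    (hB : fractional_brownian_motion H B)
    (hGamma : projection_coefficients B Gamma)
    (n : nat) (hn : (1 <= n)%N) :
  0 < Gamma n.+1 2%N.
Proof.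
apply: (@predictor_coef2_gt0 _ (fgn_autocov H) (Gamma n) _ n hn).
- exact: fgn_autocov_posdef.
- exact: fgn_autocovS_monotone.
- exact: fgn_autocov1_gt0.
(* For [n = 1] this first system is empty and the predictor is the constant 1. *)
- by move=> l ln; exact: (fgn_normal_equations hB hGamma ln).
- by move=> l ln; exact: (fgn_normal_equations hB hGamma ln).
Qed.
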